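(* Let $\mathcal{B}=\{u_1,\dots,u_N\}$ be an orthonormal basis of $\mathbb{K}^N$, with associated unitary matrix $U$, let $X$ be a Banach space over $\mathbb{K}$, and let $f\in X^N\setminus\{0\}$. Then, for all $p,q\in[1,\infty]$, with $p'$ the conjugate exponent of $p$, $$\frac{\|f\|_p\,\|\hat f\|_p}{\|f\|_q\,\|\hat f\|_q}\ge\frac{1}{\|U\|_{p',q}\,\|U^*\|_{p',q}} .$$
   Context: $\mathbb{K}$ is $\mathbb{R}$ or $\mathbb{C}$, $N\ge 1$. An $X$-valued signal is a function $f:\{1,\dots,N\}\to X$, identified with $(f(1),\dots,f(N))\in X^N$. Norms: $\|f\|_p=\left(\sum_{n=1}^N\|f(n)\|^p\right)^{1/p}$ for $p\in[1,\infty)$ and $\|f\|_\infty=\max_{1\le n\le N}\|f(n)\|$. $U$ is the $N\times N$ unitary matrix whose $k$-th column is $u_k=(u_k(1),\dots,u_k(N))$, i.e. its entry in row $n$, column $k$ is $u_k(n)$; its $n$-th row is $u(n)=(u_1(n),\dots,u_N(n))$; $U^*$ is its conjugate transpose. Graph Fourier transform of $f$: $\hat f\in X^N$, $\hat f(k)=\sum_{n=1}^N\overline{u_k(n)}f(n)$. Mixed norms: for $a,b\in[1,\infty]$, $\|U\|_{a,b}=\left(\sum_{k=1}^N\left(\sum_{n=1}^N|u_k(n)|^a\right)^{b/a}\right)^{1/b}$, i.e. the $\ell^b$ norm over $k$ of the $\ell^a$ norms of the columns $u_k$, with the usual modifications (maxima) when $a=\infty$ or $b=\infty$; hence $\|U^*\|_{a,b}$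 is the $\ell^b$ norm over $n$ of the $\ell^a$ norms of the rows $u(n)$. The conjugate exponent satisfies $1/p+1/p'=1$. *)

(* Defs.v *)
From mathcomp Require Import all_boot all_order all_algebra.
From mathcomp Require Import all_classical all_reals all_analysis.
From mathcomp Require Import complex.

Set Implicit Arguments.
Unset Strict Implicit.
Unset Printing Implicit Defensive.

Import Order.TTheory GRing.Theory Num.Theory.
Import numFieldNormedType.Exports.

Local Open Scope ring_scope.

(* The statement quantifies over [KK : scalar_field], so that "K is R or C"
   is a single universally quantified choice. *)
Inductive scalar_field := RealScalars | ComplexScalars.

Definition scalars (R : realType) (KK : scalar_field) : numFieldType :=
  match KK with
  | RealScalars => R
  | ComplexScalars => complex R
  end.

Definition scalar_conj (R : realType) (KK : scalar_field) :
    scalars R KK -> scalars R KK :=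
  match KK with
  | RealScalars => fun x => x
  | ComplexScalars => fun z => conjc z
  end.

Definition scalar_re (R : realType) (KK : scalar_field) : scalars R KK -> R :=
  match KK with
  | RealScalars => fun x => x
  | ComplexScalars => fun z => complex.Re z
  end.

(* In MathComp a norm over the field K takes its values in K (always in the
   nonnegative real part of K); [rnorm] is that same norm, seen in R. It is used
   both for the norm of X and for the modulus on K. *)
Definition rnorm (R : realType) (KK : scalar_field)
    (V : normedZmodType (scalars R KK)) (x : V) : R :=
  @scalar_re R KK `|x|.

(* The l^p norm of a finite family of nonnegative reals, for p in [1, +oo];
   the value at -oo is junk. *)
Definition lpnorm (R : realType) (N : nat) (p : \bar R) (a : 'I_N -> R) : R :=
  match p with
  | r%:E => (\sum_(n < N) a n `^ r) `^ r^-1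
  | +oo%E => \big[Num.max/0]_(n < N) a n
  | -oo%E => 0
  end.

Section GraphFourier.
Variables (R : realType) (KK : scalar_field) (N : nat).
Let K := scalars R KK.

Definition inner_prod (v w : 'cV[K]_N) : K :=
  \sum_(n < N) v n 0 * @scalar_conj R KK (w n 0).

Definition orthonormal_basis (u : 'I_N -> 'cV[K]_N) : Prop :=
  basis_of {:'cV[K]_N} [seq u k | k <- enum 'I_N] /\
  forall j k : 'I_N, inner_prod (u j) (u k) = (j == k)%:R.

Definition basis_mx (u : 'I_N -> 'cV[K]_N) : 'M[K]_N :=
  \matrix_(n, k) u k n 0.

Definition adjoint_mx (M : 'M[K]_N) : 'M[K]_N :=
  \matrix_(i, j) @scalar_conj R KK (M j i).

Definition mixed_norm (a b : \bar R) (M : 'M[K]_N) : R :=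
  lpnorm b (fun k => lpnorm a (fun n => rnorm (M n k : K))).

Definition signal_norm (X : normedModType K) (p : \bar R)
    (f : {ffun 'I_N -> X}) : R :=
  lpnorm p (fun n => rnorm (f n)).

Definition graph_fourier (X : normedModType K) (u : 'I_N -> 'cV[K]_N)
    (f : {ffun 'I_N -> X}) : {ffun 'I_N -> X} :=
  [ffun k => \sum_(n < N) @scalar_conj R KK (u k n 0) *: f n].

End GraphFourier.

(* Main.v *)
Require Import Defs.
From mathcomp Require Import all_boot all_order all_algebra.
From mathcomp Require Import all_classical all_reals all_analysis.
From mathcomp Require Import complex.

Import Order.TTheory GRing.Theory Num.Theory.
Import numFieldNormedType.Exports.

Local Open Scope ring_scope.

(** The inequality is the product of two copies of one estimate. For any family
    [v] of vectors, the coefficient [graph_fourier v f k] is a sum of the [f n]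
    weighted by the conjugate entries of [v k], so the triangle inequality and
    Hoelder's inequality bound its norm by ||v_k||_{p'} ||f||_p; taking l^q norms
    over [k] gives
      ||graph_fourier v f||_q <= ||V||_{p',q} ||f||_p
    ([le_signal_norm_graph_fourier]).

    Orthonormality enters through inversion: since U is unitary, [f] is
    recovered from [fhat] by a transform of the same shape, the one attached to
    the columns of U* ([graph_fourierK]). Applying the estimate to [u] and [f],
    and then to the columns of U* and [fhat], yields
      ||fhat||_q <= ||U||_{p',q} ||f||_p   and
      ||f||_q <= ||U*||_{p',q} ||fhat||_p,
    and the two are multiplied. Inversion also shows that [fhat] is nonzero, so
    that every quantity divided by is positive. *)

(** * Real-valued norms over the two scalar fields *)

Section Scalars.
Context {R : realType} {KK : scalar_field}.
Local Notation K := (scalars R KK).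
Implicit Types z w : K.

Lemma scalar_reD z w :
  scalar_re (z + w) = scalar_re z + scalar_re w.
Proof. by case: KK z w => [//|[a b] [c d]]. Qed.

Lemma scalar_re0 : scalar_re (0 : K) = 0.
Proof. by case: KK. Qed.

Lemma le_scalar_re z w : z <= w -> scalar_re z <= scalar_re w.
Proof. by case: KK z w => [//|z w]; rewrite lecE => /andP[]. Qed.

(** A nonnegative complex number is real, so one nonnegative factor is enough for
    the real part to be multiplicative. *)
Lemma scalar_reM_ge0 z w : 0 <= z ->
  scalar_re (z * w) = scalar_re z * scalar_re w.
Proof.
case: KK z w => [//|[a b] [c d]].
by rewrite lecE /= => /andP[/eqP -> _]; rewrite mul0r subr0.
Qed.

Lemma scalar_re_eq0 z : 0 <= z -> scalar_re z = 0 -> z = 0.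
Proof.
case: KK z => [//|[a b]].
by rewrite lecE /= => /andP[/eqP -> _] ->.
Qed.

Lemma scalar_conjK : involutive (@scalar_conj R KK).
Proof. by case: KK => [//|] z; exact: conjcK. Qed.

Lemma rnorm_scalar_conj z :
  rnorm (@scalar_conj R KK z : K) = rnorm z.
Proof.
rewrite /rnorm; case: KK z => [//|z] /=.
by rewrite -[RHS]/(complex.Re `|z|) -(normcJ z).
Qed.

Section Norm.
Context {V : normedZmodType K}.
Implicit Types x y : V.

Lemma rnorm_ge0 x : 0 <= rnorm x.
Proof. by rewrite -scalar_re0; apply: le_scalar_re. Qed.

Lemma rnorm0 : rnorm (0 : V) = 0.
Proof. by rewrite /rnorm normr0 scalar_re0. Qed.

Lemma rnorm_eq0 x : rnorm x = 0 -> x = 0.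
Proof. by move=> /scalar_re_eq0 => /(_ (normr_ge0 x)) /normr0_eq0. Qed.

Lemma ler_rnormD x y : rnorm (x + y) <= rnorm x + rnorm y.
Proof. by rewrite /rnorm -scalar_reD; apply: le_scalar_re; exact: ler_normD. Qed.

Lemma ler_rnorm_sum (I : finType) (F : I -> V) :
  rnorm (\sum_i F i) <= \sum_i rnorm (F i).
Proof.
apply: (big_ind2 (fun x (r : R) => rnorm x <= r)) => //.
- by rewrite rnorm0.
- by move=> x a y b xa yb; exact: le_trans (ler_rnormD _ _) (lerD xa yb).
Qed.
End Norm.

Lemma rnormZ (X : normedModType K) z (x : X) :
  rnorm (z *: x) = rnorm (z : K) * rnorm x.
Proof. by rewrite /rnorm normrZ scalar_reM_ge0. Qed.

End Scalars.

(** * Finite l^p norms and Hoelder's inequality *)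

Section LpNorm.
Context {R : realType} {N : nat}.
Implicit Types (a b c : 'I_N -> R) (p q : \bar R).

Lemma lpnorm_ge0 p a : 0 <= lpnorm p a.
Proof.
by case: p => [r| |] //=; [exact: powR_ge0 | exact: bigmax_ge_id].
Qed.

Lemma lpnorm_eq0 p a : (1 <= p)%E -> (forall n, 0 <= a n) ->
  lpnorm p a = 0 -> forall n, a n = 0.
Proof.
case: p => [r| |//] /= p1 a0.
- have r0 : 0 < r by apply: (lt_le_trans ltr01); rewrite -lee_fin.
  move=> /powR_eq0_eq0 /eqP; rewrite psumr_eq0 => [|i _]; last exact: powR_ge0.
  move=> /allP an n; apply: (@powR_eq0_eq0 _ _ r); apply/eqP/an.
  by rewrite mem_index_enum.
- move=> h n; apply/eqP; rewrite eq_le a0 andbT -h.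
  exact: (le_bigmax _ a n).
Qed.

Lemma le_lpnorm p a b : (1 <= p)%E -> (forall n, 0 <= a n <= b n) ->
  lpnorm p a <= lpnorm p b.
Proof.
case: p => [r| |//] /= p1 ab.
- have r0 : 0 < r by apply: (lt_le_trans ltr01); rewrite -lee_fin.
  have sum_ge0 c : \sum_(n < N) c n `^ r \in Num.nneg.
    by rewrite nnegrE sumr_ge0 // => i _; exact: powR_ge0.
  apply: ge0_ler_powR => //; first by rewrite invr_ge0 ltW.
  apply: ler_sum => n _; have /andP[a0 le_ab] := ab n.
  by apply: ge0_ler_powR; rewrite ?nnegrE ?(ltW r0) // (le_trans a0).
- by apply: le_bigmax2 => n _; case/andP: (ab n).
Qed.

Lemma lpnormZr p a (s : R) : (1 <= p)%E -> (forall n, 0 <= a n) -> 0 <= s ->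
  lpnorm p (fun n => a n * s) = lpnorm p a * s.
Proof.
case: p => [r| |] //= p1 a0 s0.
- have r0 : 0 < r by apply: (lt_le_trans ltr01); rewrite -lee_fin.
  under eq_bigr do rewrite powRM //.
  rewrite -mulr_suml powRM ?powR_ge0 //; last first.
    by apply: sumr_ge0 => i _; exact: powR_ge0.
  by rewrite -powRrM mulfV ?gt_eqF // powRr1.
- elim/big_ind2 : _ => [|x y z w -> ->|//]; first by rewrite mul0r.
  by rewrite maxr_pMl.
Qed.

Lemma lpnorm1 a : (forall n, 0 <= a n) -> lpnorm 1%E a = \sum_n a n.
Proof.
move=> a0 /=; rewrite invr1 powRr1; last first.
  by apply: sumr_ge0 => i _; exact: powR_ge0.
by apply: eq_bigr => n _; rewrite powRr1.
Qed.

Lemma hoelder_sum_1y a b : (forall n, 0 <= a n) ->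
  \sum_n a n * b n <= lpnorm 1%E a * lpnorm +oo%E b.
Proof.
move=> a0; rewrite lpnorm1 // mulr_suml; apply: ler_sum => n _.
by apply: ler_wpM2l => //; exact: (le_bigmax _ b n).
Qed.

(** The classical argument: once both families are scaled to norm 1, Young's
    inequality applied termwise sums to 1/r + 1/s = 1. *)
Lemma hoelder_sum_fin (r s : R) a b : 0 < r -> 0 < s -> r^-1 + s^-1 = 1 ->
  (forall n, 0 <= a n) -> (forall n, 0 <= b n) ->
  \sum_n a n * b n <= lpnorm r%:E a * lpnorm s%:E b.
Proof.
move=> r0 s0 rs a0 b0.
have r1 : (1 <= r%:E)%E.
  by rewrite lee_fin -invr_le1 ?unitfE ?gt_eqF // -rs lerDl invr_ge0 ltW.
have s1 : (1 <= s%:E)%E.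
  by rewrite lee_fin -invr_le1 ?unitfE ?gt_eqF // -rs lerDr invr_ge0 ltW.
have [A0|A0] := eqVneq (lpnorm r%:E a) 0.
  by rewrite A0 mul0r big1 // => n _; rewrite (lpnorm_eq0 _ _ r1 a0 A0) mul0r.
have [B0|B0] := eqVneq (lpnorm s%:E b) 0.
  by rewrite B0 mulr0 big1 // => n _; rewrite (lpnorm_eq0 _ _ s1 b0 B0) mulr0.
have sum_normalized t c : 0 < t -> (1 <= t%:E)%E -> (forall n, 0 <= c n) ->
    lpnorm t%:E c != 0 -> \sum_n (c n / lpnorm t%:E c) `^ t = 1.
  move=> t0 t1 c0 C0.
  have : lpnorm t%:E (fun n => c n / lpnorm t%:E c) = 1.
    by rewrite lpnormZr ?invr_ge0 ?lpnorm_ge0 // mulfV.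
  move=> /= /eqP; rewrite powR_eq1 invr_eq0 (gt_eqF t0) orbF.
  (* [powR] is 1 on negative bases, a case that a sum of powers excludes *)
  case/orP => [/eqP //|]; rewrite ltNge sumr_ge0 // => i _; exact: powR_ge0.
(* from here on only the two normalizations matter, not what A and B are *)
have := sum_normalized r a r0 r1 a0 A0; have := sum_normalized s b s0 s1 b0 B0.
move: A0 B0 (lpnorm_ge0 r%:E a) (lpnorm_ge0 s%:E b).
move: (lpnorm r%:E a) (lpnorm s%:E b) => A B A0 B0 A_ge0 B_ge0 sumB sumA.
have A_gt0 : 0 < A by rewrite lt_def A0.
have B_gt0 : 0 < B by rewrite lt_def B0.
suff : \sum_n (a n / A) * (b n / B) <= 1.
  under eq_bigr do rewrite mulrACA -invfM.
  by rewrite -mulr_suml ler_pdivrMr ?mulr_gt0 // mul1r.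
have -> : 1 = \sum_n ((a n / A) `^ r / r + (b n / B) `^ s / s).
  by rewrite big_split /= -!mulr_suml sumA sumB !mul1r.
apply: ler_sum => n _; apply: conjugate_powR => //.
- by rewrite divr_ge0 // ltW.
- by rewrite divr_ge0 // ltW.
Qed.

Lemma hoelder_sum p a b : (1 <= p)%E ->
  (forall n, 0 <= a n) -> (forall n, 0 <= b n) ->
  \sum_n a n * b n <= lpnorm (hoelder_conjugate p) a * lpnorm p b.
Proof.
case: p => [r| |//] p1 a0 b0; last first.
  by rewrite hoelder_conjugatey; exact: hoelder_sum_1y.
have [->|r1] := eqVneq r 1.
  rewrite hoelder_conjugate1 mulrC.
  by under eq_bigr do rewrite mulrC; exact: hoelder_sum_1y.
have r_gt1 : 1 < r by rewrite lt_def r1.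
have r_gt0 : 0 < r by apply: lt_trans r_gt1.
have rN1 : r - 1 != 0 by rewrite subr_eq0.
have -> : hoelder_conjugate r%:E = (r / (r - 1))%:E.
  rewrite /hoelder_conjugate/= eqe (gt_eqF r_gt0) -EFinD inver (negbTE rN1).
  by rewrite -EFinM.
apply: hoelder_sum_fin => //; first by rewrite divr_gt0 // subr_gt0.
by rewrite invf_div mulrBl mul1r subrK divff ?gt_eqF.
Qed.

End LpNorm.

(** * The transform attached to a family of vectors *)

Section Fourier.
Context {R : realType} {KK : scalar_field} {N : nat}.
Context {X : normedModType (scalars R KK)}.
Local Notation K := (scalars R KK).
Implicit Types (f : {ffun 'I_N -> X}) (v u : 'I_N -> 'cV[K]_N).

Lemma signal_norm_gt0 (p : \bar R) f :
  (1 <= p)%E -> f != 0 -> 0 < signal_norm p f.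
Proof.
move=> p1 f0; rewrite lt_def lpnorm_ge0 andbT; apply: contraNneq f0 => h.
apply/eqP/ffunP => n; rewrite ffunE; apply: rnorm_eq0.
exact: (lpnorm_eq0 _ _ p1 (fun n => rnorm_ge0 (f n)) h).
Qed.

(** The [k]-th coefficient is bounded by Hoelder against the column [v k]; the
    factor ||f||_p does not depend on [k] and comes out of the l^q norm. The
    family [v] is arbitrary, so that this also applies to the inverse
    transform. *)
Lemma le_signal_norm_graph_fourier v f (p q : \bar R) :
  (1 <= p)%E -> (1 <= q)%E ->
  signal_norm q (graph_fourier v f) <=
    mixed_norm (hoelder_conjugate p) q (basis_mx v) * signal_norm p f.
Proof.
move=> p1 q1; rewrite /mixed_norm -lpnormZr ?lpnorm_ge0 //; last first.
  by move=> k; exact: lpnorm_ge0.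
apply: le_lpnorm => // k; rewrite rnorm_ge0 ffunE /=.
apply: (le_trans (ler_rnorm_sum _ _)).
apply: (le_trans _ (hoelder_sum p _ _ p1 _ _)); try by move=> n; exact: rnorm_ge0.
by apply: ler_sum => n _; rewrite rnormZ rnorm_scalar_conj !mxE.
Qed.

(** Orthonormality of the columns says U* U = 1; for a square matrix this
    one-sided inverse is two-sided. *)
Lemma adjoint_basis_mxK u : orthonormal_basis u ->
  basis_mx u *m adjoint_mx (basis_mx u) = 1%:M.
Proof.
case=> _ ortho; apply: mulmx1C; apply/matrixP => k j.
rewrite !mxE eq_sym -ortho.
by apply: eq_bigr => n _; rewrite !mxE mulrC.
Qed.

(** The inverse transform is again of the form [graph_fourier v], with [v] the
    columns of U*: the conjugation built into [graph_fourier] undoes that of the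
    adjoint. *)
Definition adjoint_family u (n : 'I_N) : 'cV[K]_N :=
  col n (adjoint_mx (basis_mx u)).

Lemma basis_mx_adjoint_family u :
  basis_mx (adjoint_family u) = adjoint_mx (basis_mx u).
Proof. by apply/matrixP => i j; rewrite !mxE. Qed.

Lemma graph_fourierK u : orthonormal_basis u ->
  cancel (@graph_fourier R KK N X u) (graph_fourier (adjoint_family u)).
Proof.
move=> hu f; apply/ffunP => m; rewrite ffunE.
transitivity (\sum_n (basis_mx u *m adjoint_mx (basis_mx u)) m n *: f n).
  under [RHS]eq_bigr do rewrite mxE scaler_suml.
  rewrite exchange_big /=; apply: eq_bigr => k _.
  rewrite ffunE scaler_sumr; apply: eq_bigr => n _.
  by rewrite !mxE scalar_conjK scalerA.
rewrite adjoint_basis_mxK // (bigD1 m) //= mxE eqxx scale1r.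
rewrite big1 ?addr0 // => n nm.
by rewrite mxE eq_sym (negbTE nm) scale0r.
Qed.

End Fourier.

Theorem theorem3p3 (R : realType) (KK : scalar_field) (N : nat)
  (hN : (1 <= N)%N)
  (u : 'I_N -> 'cV[scalars R KK]_N) (hu : orthonormal_basis u)
  (X : completeNormedModType (scalars R KK))
  (f : {ffun 'I_N -> X}) (hf : f != 0)
  (p q : \bar R) (hp : (1 <= p)%E) (hq : (1 <= q)%E) :
  let U := basis_mx u in
  let fhat := graph_fourier u f in
  let p' := hoelder_conjugate p in
  1 / (mixed_norm p' q U * mixed_norm p' q (adjoint_mx U))
    <= (signal_norm p f * signal_norm p fhat)
       / (signal_norm q f * signal_norm q fhat).
Proof.
cbv zeta; set U := basis_mx u; set fhat := graph_fourier u f.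
set p' := hoelder_conjugate p.
have fhatK : graph_fourier (adjoint_family u) fhat = f by exact: graph_fourierK.
have hfhat : fhat != 0.
  apply: contraNneq hf => fhat0; apply/eqP/ffunP => n.
  rewrite -fhatK fhat0 !ffunE big1 // => k _.
  by rewrite ffunE scaler0.
have le_fhat : signal_norm q fhat <= mixed_norm p' q U * signal_norm p f.
  exact: le_signal_norm_graph_fourier.
have le_f :
    signal_norm q f <= mixed_norm p' q (adjoint_mx U) * signal_norm p fhat.
  rewrite -basis_mx_adjoint_family -{1}fhatK.
  exact: le_signal_norm_graph_fourier.
have f_gt0 r : (1 <= r)%E -> 0 < signal_norm r f.
  by move=> r1; exact: signal_norm_gt0.
have fhat_gt0 r : (1 <= r)%E -> 0 < signal_norm r fhat.
  by move=> r1; exact: signal_norm_gt0.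
(* the mixed norms are positive because each bounds a positive norm *)
have U_gt0 : 0 < mixed_norm p' q U.
  by rewrite -(pmulr_lgt0 _ (f_gt0 p hp)) (lt_le_trans _ le_fhat) ?fhat_gt0.
have Us_gt0 : 0 < mixed_norm p' q (adjoint_mx U).
  by rewrite -(pmulr_lgt0 _ (fhat_gt0 p hp)) (lt_le_trans _ le_f) ?f_gt0.
rewrite ler_pdivrMr ?mulr_gt0 // mulrAC.
rewrite ler_pdivlMr ?mulr_gt0 ?f_gt0 ?fhat_gt0 // mul1r.
rewrite mulrC [leRHS]mulrC [leRHS]mulrACA.
by apply: ler_pM => //; rewrite ltW // ?f_gt0 ?fhat_gt0.
Qed.
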